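(* Let $G$ be a group given by a presentation $\langle X\mid R\rangle$ with reversible relations. Let $U$ be a length-$\ell$ factorization of elements of $G$, and let $V$ be a double reverse of $U$. Then $U$ and $V$ have Hurwitz orbits of the same size.
   Context: $X=\{x_1,\ldots,x_n\}$, $F(X)$ is the free group on $X$ (reduced words on $X\cup X^{-1}$), and $\langle X\mid R\rangle$ with $R\subset F(X)$ presents $G\cong F(X)/N$, $N$ the normal closure of $R$ in $F(X)$. For $a=x_{i_1}\cdots x_{i_p}\in F(X)$ with letters in $X\cup X^{-1}$, the reverse is $a^*=x_{i_p}\cdots x_{i_1}$. The presentation has reversible relations if $r^*\in N$ for every $r\in R$. A factorization is a tuple of elements of $G$; two length-$\ell$ factorizations $U,V$ are double reverses if there exist $a_1,\ldots,a_\ell\in F(X)$ with $U=(a_1,\ldots,a_\ell)$ and $V=(a_\ell^*,\ldots,a_1^* )$ (entries taken as elements of $G$). For $1\le i\le\ell-1$, the Hurwitz move $\sigma_i$ sends $(x_1,\ldots,x_i,x_{i+1},\ldots,x_\ell)$ to $(x_1,\ldots,x_{i+1},x_{i+1}^{-1}x_ix_{i+1},\ldots,x_\ell)$, with inverse $\sigma_i^{-1}$ sending it to $(x_1,\ldots,x_ix_{i+1}x_i^{-1},x_i,\ldots,x_\ell)$. The Hurwitz orbit of a factorization is the set of factorizations obtainable from it by finite sequences of Hurwitz moves and their inverses; its size is its cardinality. *)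

(* Defs.v *)
From HB Require Import structures.
From mathcomp Require Import all_boot monoid.
From mathcomp Require Import boolp classical_sets functions cardinality.

Set Implicit Arguments.
Unset Strict Implicit.
Unset Printing Implicit Defensive.

Local Open Scope classical_set_scope.
Local Open Scope group_scope.

Section FreeGroup.
Variable X : choiceType.

(* The letter (x, false) stands for x and (x, true) for its inverse. *)
Definition letter : Type := (X * bool)%type.
HB.instance Definition _ := Choice.on letter.

Definition linv (a : letter) : letter := (a.1, ~~ a.2).

Definition reduced (w : seq letter) : bool :=
  sorted (fun a b => b != linv a) w.

Record freeGroup := FreeGroup { fword :> seq letter; fwordP : reduced fword }.
HB.instance Definition _ := [isSub for fword].
HB.instance Definition _ := [Choice of freeGroup by <:].

Definition push (a : letter) (w : seq letter) : seq letter :=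
  if w is b :: w' then if b == linv a then w' else a :: w else [:: a].

Definition reduce (w : seq letter) : seq letter := foldr push [::] w.

Lemma linvK : involutive linv.
Proof. by case=> x b; rewrite /linv /= negbK. Qed.

Lemma linv_sym (a b : letter) : (b == linv a) = (a == linv b).
Proof. by apply/eqP/eqP => ->; rewrite linvK. Qed.

Lemma push_reduced a w : reduced w -> reduced (push a w).
Proof.
case: w => [|b w] //= bw; case: ifPn => [_|ne]; first exact: path_sorted bw.
by rewrite /= ne.
Qed.

Lemma foldr_push_reduced w v : reduced v -> reduced (foldr push v w).
Proof. by move=> rv; elim: w => //= a w; exact: push_reduced. Qed.

Lemma reduce_reduced w : reduced (reduce w).
Proof. exact: foldr_push_reduced. Qed.

Lemma reduce_id w : reduced w -> reduce w = w.
Proof.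
elim: w => //= a w IH aw; rewrite IH; last exact: path_sorted aw.
by case: w aw {IH} => //= b w /andP[/negPf->].
Qed.

Lemma pushK a w : reduced w -> push a (push (linv a) w) = w.
Proof.
case: w => [|b w] /=; first by rewrite eqxx.
rewrite linvK; have [-> aw|ne _] := eqVneq b a; last by rewrite /= eqxx.
by case: w aw => //= c w /andP[/negPf->].
Qed.

Lemma foldr_push_push a w v :
  reduced v -> foldr push v (push a w) = push a (foldr push v w).
Proof.
move=> rv; case: w => [|b w] //=; case: eqP => [->|//].
by rewrite pushK //; exact: foldr_push_reduced.
Qed.

Lemma foldr_push_reduce w v :
  reduced v -> foldr push v (reduce w) = foldr push v w.
Proof. by move=> rv; elim: w => //= a w <-; rewrite foldr_push_push. Qed.

Lemma reduce_cat w v : reduce (w ++ v) = foldr push (reduce v) w.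
Proof. by rewrite /reduce foldr_cat. Qed.

Lemma reduce_catl w v : reduce (reduce w ++ v) = reduce (w ++ v).
Proof. by rewrite !reduce_cat foldr_push_reduce ?reduce_reduced. Qed.

Lemma reduce_catr w v : reduce (w ++ reduce v) = reduce (w ++ v).
Proof. by rewrite !reduce_cat (reduce_id (reduce_reduced v)). Qed.

Definition winv (w : seq letter) : seq letter := rev (map linv w).

Lemma reduced_rev w : reduced (rev w) = reduced w.
Proof.
by rewrite /reduced rev_sorted; apply: eq_sorted => a b; rewrite linv_sym.
Qed.

Lemma winv_reduced w : reduced w -> reduced (winv w).
Proof.
rewrite /winv reduced_rev /reduced sorted_map; apply: sub_sorted => a b /=.
by rewrite (inj_eq (can_inj linvK)).
Qed.

Lemma reduce_winvl w : reduce (winv w ++ w) = [::].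
Proof.
elim: w => //= a w IH; rewrite /winv /= rev_cons cat_rcons reduce_cat /=.
have := pushK (linv a) (reduce_reduced w); rewrite linvK => ->.
by rewrite -reduce_cat.
Qed.

Lemma winvK : involutive winv.
Proof. by move=> w; rewrite /winv map_rev revK mapK //; exact: linvK. Qed.

Lemma reduce_winvr w : reduce (w ++ winv w) = [::].
Proof. by rewrite -{1}[w]winvK reduce_winvl. Qed.

Definition fone : freeGroup := @FreeGroup [::] isT.
Definition fmul (a b : freeGroup) : freeGroup :=
  FreeGroup (reduce_reduced (a ++ b)).
Definition finv (a : freeGroup) : freeGroup :=
  FreeGroup (winv_reduced (fwordP a)).

Lemma fmulA : associative fmul.
Proof.
by move=> a b c; apply: val_inj; rewrite /= reduce_catl reduce_catr catA.
Qed.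

Lemma fmul1 : left_id fone fmul.
Proof. by move=> a; apply: val_inj; rewrite /= reduce_id ?fwordP. Qed.

Lemma fmulr1 : right_id fone fmul.
Proof. by move=> a; apply: val_inj; rewrite /= cats0 reduce_id ?fwordP. Qed.

Lemma fmulV : left_inverse fone finv fmul.
Proof. by move=> a; apply: val_inj; rewrite /= reduce_winvl. Qed.

Lemma fmulrV : right_inverse fone finv fmul.
Proof. by move=> a; apply: val_inj; rewrite /= reduce_winvr. Qed.

HB.instance Definition _ :=
  isGroup.Build freeGroup fmulA fmul1 fmulr1 fmulV fmulrV.

Lemma fstar_subproof (a : freeGroup) : reduced (rev a).
Proof. by rewrite reduced_rev fwordP. Qed.

(* The letters themselves are kept: only their order is reversed. *)
Definition fstar (a : freeGroup) : freeGroup := FreeGroup (fstar_subproof a).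

End FreeGroup.

Definition normal_subgroup (F : groupType) (S : set F) : Prop :=
  [/\ S 1,
      forall a b, S a -> S b -> S (a * b),
      forall a, S a -> S a^-1
    & forall a c, S a -> S (c^-1 * a * c)].

Definition normal_closure (F : groupType) (R : set F) : set F :=
  smallest (@normal_subgroup F) R.

(* The isomorphism of G with F(X)/N is given by the induced epimorphism
   [phi : F(X) -> G] with kernel N; [phi a] is then "a taken in G". *)
Definition presents (X : choiceType) (R : set (freeGroup X)) (G : groupType)
    (phi : {multiplicative freeGroup X -> G}) : Prop :=
  (forall g : G, exists a, phi a = g) /\
  phi @^-1` [set 1] = normal_closure R.

Definition reversible_relations (X : choiceType) (R : set (freeGroup X)) :
    Prop :=
  forall r, R r -> normal_closure R (fstar r).

Definition double_reverses (X : choiceType) (G : groupType)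
    (phi : {multiplicative freeGroup X -> G}) (l : nat)
    (U V : l.-tuple G) : Prop :=
  exists a : l.-tuple (freeGroup X),
    (forall i, tnth U i = phi (tnth a i)) /\
    (forall i, tnth V i = phi (fstar (tnth a (rev_ord i)))).

Section Hurwitz.
Variables (G : groupType) (l : nat).

(* Used only at consecutive positions, [j = i.+1]. *)
Definition hurwitz_move (i j : 'I_l) (U : l.-tuple G) : l.-tuple G :=
  [tuple if k == i then tnth U j
         else if k == j then (tnth U j)^-1 * tnth U i * tnth U j
         else tnth U k | k < l].

Definition hurwitz_move_inv (i j : 'I_l) (U : l.-tuple G) : l.-tuple G :=
  [tuple if k == i then tnth U i * tnth U j * (tnth U i)^-1
         else if k == j then tnth U i
         else tnth U k | k < l].

Inductive hurwitz_reachable (U : l.-tuple G) : l.-tuple G -> Prop :=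
| hurwitz_refl : hurwitz_reachable U U
| hurwitz_step (i j : 'I_l) (W : l.-tuple G) :
    j = i.+1 :> nat -> hurwitz_reachable U W ->
    hurwitz_reachable U (hurwitz_move i j W)
| hurwitz_step_inv (i j : 'I_l) (W : l.-tuple G) :
    j = i.+1 :> nat -> hurwitz_reachable U W ->
    hurwitz_reachable U (hurwitz_move_inv i j W).

Definition hurwitz_orbit (U : l.-tuple G) : set (l.-tuple G) :=
  [set W | hurwitz_reachable U W].

End Hurwitz.

(* Main.v *)
Require Import Defs.
From mathcomp Require Import all_boot monoid.
From mathcomp Require Import boolp classical_sets functions cardinality.

(** Reversal of words is an involutive anti-automorphism of F(X). When the
    relations are reversible it preserves N, hence descends to an involutive
    anti-automorphism of G. Applying the latter entrywise and reversing the
    order of the entries is an involution on factorizations which exchanges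
    sigma_i with the inverse of sigma_(l-i), so it maps the Hurwitz orbit of U
    bijectively onto that of its double reverse V. *)

Local Open Scope classical_set_scope.
Local Open Scope card_scope.
Local Open Scope group_scope.

(** [push] cancels at the front of a word, so after reversal the cancelling pair sits at the end,
    where reducing the suffix first removes it. *)
Lemma rev_push {X : choiceType} (a : letter X) (w : seq (letter X)) :
  reduced w -> rev (push a w) = reduce (rev (a :: w)).
Proof.
case: w => [//|b w] bw.
rewrite /push; case: eqP => [->|/eqP ne]; last first.
  by rewrite reduce_id // reduced_rev /reduced /= ne.
rewrite !rev_cons -!cats1 -catA -reduce_catr /= linvK eqxx cats0 reduce_id //.
by rewrite reduced_rev; exact: path_sorted bw.
Qed.

Lemma rev_reduce {X : choiceType} (w : seq (letter X)) :
  rev (reduce w) = reduce (rev w).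
Proof.
elim: w => //= a w IH; rewrite rev_push ?reduce_reduced //.
by rewrite !rev_cons -!cats1 IH reduce_catl.
Qed.

Lemma fstarM {X : choiceType} (a b : freeGroup X) :
  fstar (a * b) = fstar b * fstar a.
Proof. by apply: val_inj; rewrite /= rev_reduce rev_cat. Qed.

Lemma fstarK {X : choiceType} : involutive (@fstar X).
Proof. by move=> a; apply: val_inj; rewrite /= revK. Qed.

Lemma fstar1 {X : choiceType} : fstar (1 : freeGroup X) = 1.
Proof. exact: val_inj. Qed.

Lemma fstarV {X : choiceType} (a : freeGroup X) : fstar a^-1 = (fstar a)^-1.
Proof. by apply: val_inj; rewrite /= /winv map_rev. Qed.

Lemma multiplicative1 {G H : groupType} (f : {multiplicative G -> H}) :
  f 1 = 1.
Proof. by apply: (mulgI (f 1)); rewrite -gmulfM !mulg1. Qed.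

Lemma multiplicativeV {G H : groupType} (f : {multiplicative G -> H}) g :
  f g^-1 = (f g)^-1.
Proof.
by apply: (mulgI (f g)); rewrite -gmulfM !mulgV multiplicative1.
Qed.

Section Star.
Context {X : choiceType} {R : set (freeGroup X)} {G : groupType}.
Context {phi : {multiplicative freeGroup X -> G}}.
Hypotheses (hpres : presents R phi) (hrev : reversible_relations R).

Lemma presents_ker (a : freeGroup X) : normal_closure R a <-> phi a = 1.
Proof. by case: hpres => _ <-. Qed.

(** The elements whose reverse dies in [G] form a normal subgroup, and it contains [R] because the
    relations are reversible; minimality of the normal closure concludes. *)
Lemma fstar_ker (a : freeGroup X) : phi a = 1 -> phi (fstar a) = 1.
Proof.
move/presents_ker => Na; apply: (Na [set b | phi (fstar b) = 1]); split => /=.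
  split=> [|b c|b|b c] /=.
  - by rewrite fstar1 multiplicative1.
  - by move=> hb hc; rewrite fstarM gmulfM hb hc mulg1.
  - by move=> hb; rewrite fstarV multiplicativeV hb invg1.
  - by move=> hb; rewrite !fstarM fstarV !gmulfM multiplicativeV hb mul1g mulgV.
by move=> r /hrev /presents_ker.
Qed.

(** Well-definedness of reversal on [G], by applying [fstar_ker] to [a * b^-1]. *)
Lemma fstar_fiber (a b : freeGroup X) :
  phi a = phi b -> phi (fstar a) = phi (fstar b).
Proof.
move=> ab; have /fstar_ker : phi (a * b^-1) = 1.
  by rewrite gmulfM multiplicativeV ab mulgV.
rewrite fstarM fstarV gmulfM multiplicativeV => h.
by apply: (mulgI (phi (fstar b))^-1); rewrite h mulVg.
Qed.

Lemma star_exists : exists star : G -> G,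
  [/\ forall a, star (phi a) = phi (fstar a),
      involutive star
    & forall g h, star (g * h) = star h * star g].
Proof.
(* [pre] is an arbitrary section of [phi]; by [fstar_fiber] the choice does not affect [star]. *)
have [pre preE] := choice hpres.1.
pose star g := phi (fstar (pre g)).
have starE a : star (phi a) = phi (fstar a) by apply: fstar_fiber.
exists star; split=> // [g|g h].
  by rewrite -[g]preE !starE fstarK.
by rewrite -[g]preE -[h]preE -gmulfM !starE fstarM gmulfM.
Qed.

End Star.

Section DoubleReverse.
Context {G : groupType} {l : nat} {star : G -> G}.
Hypotheses (starK : involutive star).
Hypotheses (starM : forall g h, star (g * h) = star h * star g).

Definition double_reverse (W : l.-tuple G) : l.-tuple G :=
  [tuple star (tnth W (rev_ord k)) | k < l].

Lemma double_reverseK : involutive double_reverse.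
Proof.
by move=> W; apply: eq_from_tnth => k; rewrite !tnth_mktuple rev_ordK starK.
Qed.

Lemma star1 : star 1 = 1.
Proof.
by apply: (mulgI (star 1)); rewrite -starM !mulg1.
Qed.

Lemma starV g : star g^-1 = (star g)^-1.
Proof. by apply: (mulgI (star g)); rewrite -starM mulVg mulgV star1. Qed.

(** The conjugate [x_j^-1 * x_i * x_j] becomes [star x_j * star x_i * (star x_j)^-1], the first new
    entry of the inverse move at the mirrored positions. *)
Lemma double_reverse_move (i j : 'I_l) W : i != j ->
  double_reverse (hurwitz_move i j W) =
  hurwitz_move_inv (rev_ord j) (rev_ord i) (double_reverse W).
Proof.
move=> ij; apply: eq_from_tnth => k; rewrite !tnth_mktuple !rev_ordK.
rewrite !(can2_eq rev_ordK rev_ordK).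
(* The two sides test the two positions in opposite orders; [i != j] reconciles them. *)
case: (eqVneq k (rev_ord i)) => [->|_].
  by rewrite (inj_eq rev_ord_inj) (negPf ij).
by case: eqP => // _; rewrite !starM starV mulgA.
Qed.

Lemma double_reverse_move_inv (i j : 'I_l) W : i != j ->
  double_reverse (hurwitz_move_inv i j W) =
  hurwitz_move (rev_ord j) (rev_ord i) (double_reverse W).
Proof.
move=> ij; apply: eq_from_tnth => k; rewrite !tnth_mktuple !rev_ordK.
rewrite !(can2_eq rev_ordK rev_ordK).
case: (eqVneq k (rev_ord i)) => [->|_].
  by rewrite (inj_eq rev_ord_inj) (negPf ij) !starM starV mulgA.
by case: eqP.
Qed.

Lemma double_reverse_reachable U W : hurwitz_reachable U W ->
  hurwitz_reachable (double_reverse U) (double_reverse W).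
Proof.
have rev_succ (i j : 'I_l) : j = i.+1 :> nat ->
    i != j /\ rev_ord i = (rev_ord j).+1 :> nat.
  move=> ji; rewrite -val_eqE /= ji neq_ltn ltnSn; split=> //.
  by rewrite -ji -subSn.
elim=> [|i j {}W /rev_succ[ij ji] _|i j {}W /rev_succ[ij ji] _].
- exact: hurwitz_refl.
- by rewrite double_reverse_move //; exact: hurwitz_step_inv.
- by rewrite double_reverse_move_inv //; exact: hurwitz_step.
Qed.

(** Reachability is preserved by an involution, so applying it a second time gives the converse
    inclusion. *)
Lemma double_reverse_orbit U :
  hurwitz_orbit (double_reverse U) = double_reverse @` hurwitz_orbit U.
Proof.
apply/seteqP; split=> [W /double_reverse_reachable|_ [W UW <-]].
  rewrite double_reverseK => UW; exists (double_reverse W) => //.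
  exact: double_reverseK.
exact: double_reverse_reachable.
Qed.

End DoubleReverse.

Theorem theorem6p6 (n : nat) (R : set (freeGroup 'I_n)) (G : groupType)
    (phi : {multiplicative freeGroup 'I_n -> G})
    (hpres : presents R phi) (hrev : reversible_relations R)
    (l : nat) (U V : l.-tuple G) (hUV : double_reverses phi U V) :
  hurwitz_orbit U #= hurwitz_orbit V.
Proof.
have [star [starE starK starM]] := star_exists hpres hrev.
have [a [Ua Va]] := hUV.
(* By [starE], [V] depends only on [U] and not on the words in [a]. *)
have -> : V = double_reverse (star := star) U.
  by apply: eq_from_tnth => k; rewrite tnth_mktuple Va Ua starE.
rewrite double_reverse_orbit // card_eq_sym; apply: inj_card_eq.
by move=> W W' _ _; exact: (can_inj (double_reverseK starK)).
Qed.
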